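(* Let $p,n\in\mathbb N$ with $p\ge n\ge 15$ and $p=k(n-1)+n-8$ for some $k\in\mathbb N$. Then $$\mathrm{ex}(p;T_n^3)=\frac{(n-2)p-7n+30}2+\max\Big\{\Big\lfloor\frac n2\Big\rfloor,13\Big\}.$$
   Context: All graphs are finite simple graphs. For a graph $L$, $\mathrm{ex}(p;L)$ denotes the maximum number of edges in a graph on $p$ vertices that contains no subgraph isomorphic to $L$. For $n\ge 6$, $T_n^3$ is the tree on vertex set $\{v_0,\ldots,v_{n-1}\}$ with edge set $\{v_0v_1,v_0v_2,\ldots,v_0v_{n-4},\ v_1v_{n-3},\ v_1v_{n-2},\ v_1v_{n-1}\}$. $\lfloor x\rfloor$ is the greatest integer not exceeding $x$; $\mathbb N=\{1,2,\ldots\}$. *)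

(* Defs.v *)
From mathcomp Require Import all_boot.
Set Implicit Arguments. Unset Strict Implicit. Unset Printing Implicit Defensive.

Definition sgraph (p : nat) := {set {set 'I_p}}.

Definition is_simple (p : nat) (E : sgraph p) : bool :=
  [forall e in E, #|e| == 2].

Definition contains (m p : nat) (L : sgraph m) (G : sgraph p) : bool :=
  [exists f : {ffun 'I_m -> 'I_p},
     injectiveb f && [forall e in L, (f @: e) \in G]].

Definition ex (p m : nat) (L : sgraph m) : nat :=
  \max_(G : sgraph p | is_simple G && ~~ contains L G) #|G|.

Definition Tn3_adj (n : nat) (i j : 'I_n) : bool :=
  ((i == 0 :> nat) && (1 <= j <= n - 4)) || ((i == 1 :> nat) && (n - 3 <= j <= n - 1)).

Definition Tn3 (n : nat) : sgraph n :=
  [set e : {set 'I_n} | [exists i : 'I_n, exists j : 'I_n, Tn3_adj i j && (e == [set i; j])]].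

(* Main.v *)
Require Import Defs.
From mathcomp Require Import all_boot zify.
Set Implicit Arguments. Unset Strict Implicit. Unset Printing Implicit Defensive.

(** Give a [T_n^3]-free graph the defect [(n - 2) |U| - sum of degrees]; it is
    additive when a vertex set is deleted, and an upper bound on edges is a lower
    bound on the defect.  [T_n^3]-freeness is local: if [v] has degree [n - 4 + s]
    and a neighbour [a] of [v] has degree at least 4, then [a] has at most [2 - s]
    neighbours outside the closed neighbourhood of [v].

    Hence a vertex of degree at least [n - 2] yields [n - 1] vertices whose
    deletion does not increase the defect, while a vertex of degree [n - 3] either
    does the same or yields [n - 2] vertices carrying a defect of at least [n - 6].
    Deleting such sets keeps [|U|] in its residue class modulo [n - 1], or moves it
    to the next one.  In a graph of maximum degree [n - 4] the defect is at least
    [2 |U|], which suffices except for [|U| = 2n - 8] and [|U| = 2n - 9]; there one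
    compares the closed neighbourhood of a vertex of degree [n - 4] with the rest.

    The two extremal graphs are disjoint unions of cliques [K_(n-1)] with either
    [K_(n-8)] or a nearly [(n - 5)]-regular graph on [2n - 9] vertices. *)

Lemma subset_of_card (T : finType) (A : {set T}) k :
  k <= #|A| -> exists2 B : {set T}, B \subset A & #|B| = k.
Proof.
move=> kA; exists [set x in take k (enum A)].
  by apply/subsetP=> x; rewrite inE => /mem_take; rewrite mem_enum.
by rewrite cardsE (card_uniqP (take_uniq _ (enum_uniq _))) size_takel -?cardE.
Qed.

(** * Upper bound *)

Section Graph.
Variables (V : finType) (e : rel V).
Hypotheses (e_sym : symmetric e) (e_irr : irreflexive e).
Implicit Types (U S X Y Z : {set V}) (u v w a b : V).

Definition nbr U v := [set w in U | e v w].
Definition deg U v := #|nbr U v|.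
Definition cnbr U v := v |: nbr U v.
Definition sumdeg U := \sum_(v in U) deg U v.

(** [T_n^3] is a double star: adjacent centres [v] and [a] with n - 5 and 3 further leaves. Stated
    for a relation, its absence makes sense on any finite type. *)
Definition dstar_free n := forall v a X Y,
  e v a -> X \subset nbr setT v :\ a -> Y \subset nbr setT a :\ v ->
  #|X| = n - 5 -> #|Y| = 3 -> ~~ [disjoint X & Y].

Lemma in_nbr U v w : (w \in nbr U v) = (w \in U) && e v w.
Proof. by rewrite inE. Qed.

Lemma degE U v : deg U v = \sum_(w in U) e v w.
Proof.
rewrite /deg -sum1dep_card big_mkcondr /=.
by apply: eq_bigr => w _; case: (e v w).
Qed.

Lemma degD S U v : S \subset U -> deg U v = deg S v + deg (U :\: S) v.
Proof.
move=> SU; rewrite !degE (big_setID S) /= (setIidPr SU) //.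
Qed.

Lemma deg_sub S U v : S \subset U -> deg S v <= deg U v.
Proof. by move=> SU; rewrite (degD v SU) leq_addr. Qed.

Lemma card_cnbr U v : #|cnbr U v| = (deg U v).+1.
Proof. by rewrite cardsU1 in_nbr e_irr andbF. Qed.

Lemma cnbr_sub U v : v \in U -> cnbr U v \subset U.
Proof.
move=> vU; apply/subsetP=> w; rewrite !inE.
by case/orP=> [/eqP->|/andP[]].
Qed.

Lemma deg_lt_card U v : v \in U -> deg U v < #|U|.
Proof. by move=> vU; rewrite -card_cnbr subset_leq_card ?cnbr_sub. Qed.

Lemma deg_pos U v w : w \in U -> e v w -> 0 < deg U v.
Proof. by move=> wU vw; apply/card_gt0P; exists w; rewrite in_nbr wU. Qed.

Lemma sumdeg_le U : sumdeg U <= #|U| * #|U|.-1.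
Proof.
rewrite /sumdeg -sum_nat_const; apply: leq_sum => v vU.
by have := deg_lt_card vU; lia.
Qed.

(* An edge inside [S] is counted twice by [deg U], an edge leaving [S] once by
   [deg U] and once by [deg (U :\: S)]. *)
Lemma sumdeg_remove S U : S \subset U ->
  sumdeg U = sumdeg (U :\: S) + \sum_(a in S) (deg U a + deg (U :\: S) a).
Proof.
move=> SU; rewrite /sumdeg (big_setID S) /= (setIidPr SU) big_split /=.
suff -> : \sum_(v in U :\: S) deg U v =
  \sum_(v in U :\: S) deg (U :\: S) v + \sum_(a in S) deg (U :\: S) a by lia.
under eq_bigr => v _ do rewrite (degD v SU).
rewrite big_split /= addnC; congr (_ + _).
under eq_bigr => v _ do rewrite degE.
rewrite exchange_big /=; apply: eq_bigr => a _; rewrite degE.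
by apply: eq_bigr => v _; rewrite e_sym.
Qed.

(** * Local consequences of freeness, and removable sets *)

Section Free.
Variable n : nat.
Hypotheses (n_ge : 15 <= n) (e_free : dstar_free n).

(** Three leaves for [a] are taken outside the closed neighbourhood of [v] as far as possible; were
    the bound false, the neighbours of [v] left over would still supply n - 5 leaves. *)
Lemma free_out U v a : v \in U -> a \in U -> e v a -> n - 4 <= deg U v ->
  4 <= deg U a -> deg (U :\: cnbr U v) a + deg U v <= n - 2.
Proof.
move=> vU aU va dv da; rewrite leqNgt; apply/negP => big.
pose O := nbr (U :\: cnbr U v) a; pose I := nbr U a :&: nbr U v.
have av : e a v by rewrite e_sym.
have dO : deg (U :\: cnbr U v) a = #|O| by [].
have dis : [disjoint O & I].
  rewrite -setI_eq0; apply/eqP/setP=> w; rewrite !inE.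
  by case: (e v w); case: (w \in U); rewrite ?orbT ?andbF.
have NA : nbr U a = v |: (O :|: I).
  apply/setP=> w; rewrite !inE; have [->|wv] := eqVneq w v; rewrite ?vU ?av //=.
  by case: (w \in U); case: (e a w); case: (e v w).
have cOI : #|O :|: I| = #|O| + #|I| by rewrite cardsU (disjoint_setI0 dis) cards0 subn0.
have vOI : v \notin O :|: I by rewrite !inE eqxx e_irr !andbF.
have cA : deg U a = (#|O| + #|I|).+1 by rewrite /deg NA cardsU1 vOI cOI.
have subOI : O :|: I \subset nbr setT a :\ v.
  apply/subsetP=> w wOI; have wv : w != v by apply: contraNneq vOI => <-.
  have : w \in nbr U a by rewrite NA inE wOI orbT.
  by rewrite !inE wv => /andP[].
have [Y YOI [cY YI]] : exists2 Y : {set V}, Y \subset O :|: I & #|Y| = 3 /\ #|Y :&: I| <= 3 - #|O|.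
  case: (leqP 3 #|O|) => O3.
    have [Y YO cY] := subset_of_card O3; exists Y.
      by rewrite subsetU // YO.
    split=> //; have -> : Y :&: I = set0.
      by apply/eqP; rewrite setI_eq0; apply: disjointWl dis.
    by rewrite cards0.
  have I3 : 3 - #|O| <= #|I| by lia.
  have [J JI cJ] := subset_of_card I3.
  exists (O :|: J); first exact: setUS.
  have OJ : O :&: J = set0 by apply/eqP; rewrite setI_eq0; apply: disjointWr dis.
  split; first by rewrite cardsU OJ cards0 cJ; lia.
  rewrite setIUl (disjoint_setI0 dis) set0U.
  by apply: leq_trans (subset_leq_card (subsetIl _ _)) _; rewrite cJ.
have cX : n - 5 <= #|(nbr U v :\ a) :\: Y|.
  have c1 : #|nbr U v :\ a| = (deg U v).-1.
    by have := cardsD1 a (nbr U v); rewrite in_nbr aU va /= -/(deg U v) => ->.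
  rewrite cardsD c1.
  have : #|(nbr U v :\ a) :&: Y| <= #|Y :&: I|.
    apply: subset_leq_card; apply/subsetP => w; rewrite !inE => /andP[/and3P[wa wU vw] wY].
    have := subsetP (subset_trans YOI subOI) _ wY; rewrite !inE => /andP[_ aw].
    by rewrite wY wU vw aw.
  by lia.
have [X XD cX5] := subset_of_card cX.
have XN : X \subset nbr setT v :\ a.
  apply: subset_trans XD _; apply/subsetP => w.
  by rewrite !inE => /andP[_ /and3P[-> _ ->]].
have /negP[] := e_free va XN (subset_trans YOI subOI) cX5 cY.
rewrite -setI_eq0; apply/eqP/setP => w; rewrite !inE; apply/negP => /andP[wX wY].
by have := subsetP XD _ wX; rewrite inE wY.
Qed.

Lemma free_out2 U v a : v \in U -> a \in U -> e v a -> n - 4 <= deg U v ->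
  deg (U :\: cnbr U v) a <= 2.
Proof.
move=> vU aU va dv; case: (leqP 4 (deg U a)) => da.
  by have := free_out vU aU va dv da; lia.
have := degD a (cnbr_sub vU); have : 0 < deg (cnbr U v) a; last by lia.
by apply: (@deg_pos _ _ v); rewrite ?setU11 // e_sym.
Qed.

(** By [sumdeg_remove] these add up over [S] to the drop of [sumdeg] when [S] is deleted, so an
    average of at most n - 2 keeps the defect from growing. *)
Definition cost U S a := deg U a + deg (U :\: S) a.

Definition removable U S :=
  [/\ S \subset U, #|S| = n - 1 & \sum_(a in S) cost U S a <= (n - 1) * (n - 2)].

Lemma cost_low U S v a :
  S \subset U -> v \in S -> e v a -> deg U a <= 3 -> cost U S a <= 5.
Proof.
move=> SU vS va da; rewrite /cost.
have := degD a SU; have : 0 < deg S a; last by lia.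
by apply: (@deg_pos _ _ v); rewrite // e_sym.
Qed.

Lemma out_center U v : deg (U :\: cnbr U v) v = 0.
Proof.
apply/eqP; rewrite cards_eq0; apply/eqP/setP => w; rewrite !inE.
by case: (e v w); case: (w \in U); rewrite ?andbF ?orbT.
Qed.

Lemma cnbrP U v a : a \in cnbr U v -> a = v \/ a \in U /\ e v a.
Proof. by rewrite !inE => /orP[/eqP->|/andP[]]; [left | right]. Qed.

Lemma exists_removable U v : v \in U -> n - 2 <= deg U v -> exists S, removable U S.
Proof.
move=> vU; rewrite leq_eqVlt => /orP[/eqP dv | dv].
  have SU := cnbr_sub vU; exists (cnbr U v); split=> //; first by rewrite card_cnbr; lia.
  have <- : #|cnbr U v| = n - 1 by rewrite card_cnbr; lia.
  rewrite -sum_nat_const; apply: leq_sum => a aS.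
  have [->|[aU va]] := cnbrP aS; first by rewrite /cost out_center; lia.
  case: (leqP 4 (deg U a)) => da; last first.
    by have := cost_low SU (setU11 _ _) va; rewrite /cost; lia.
  have := free_out vU aU va; have := deg_lt_card aS.
  have := degD a SU; rewrite /cost card_cnbr.
  by move=> *; lia.
(* Now [free_out] forces every neighbour of [v] to have degree at most 3, so any n - 1 of them are
   cheap. *)
have c : n - 1 <= #|nbr U v| by rewrite -/(deg U v); lia.
have [S SN cS] := subset_of_card c.
have SU : S \subset U by apply: subset_trans SN _; apply/subsetP=> w; rewrite in_nbr => /andP[].
exists S; split=> //; rewrite -cS -sum_nat_const; apply: leq_sum => a aS.
have := subsetP SN _ aS; rewrite in_nbr => /andP[aU va].
have := free_out vU aU va; have := deg_sub a (subsetDl U S); rewrite /cost; lia.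
Qed.

Lemma sum_cost_le U S X Z k :
  {in X, forall a, cost U S a + (a \notin Z) <= k} ->
  \sum_(a in X) cost U S a + #|X :\: Z| <= #|X| * k.
Proof.
move=> XZ; have -> : #|X :\: Z| = \sum_(a in X) (a \notin Z).
  rewrite -sum1_card (eq_bigl (fun a => (a \in X) && (a \notin Z))).
    by rewrite big_mkcondr; apply: eq_bigr => a _; case: (a \in Z).
  by move=> a; rewrite inE andbC.
by rewrite -sum_nat_const -big_split; apply: leq_sum.
Qed.

(* The vertices [a] of [Z] are those for which deleting the closed neighbourhood
   [S] of [v] gains nothing.  Either an outside neighbour [b] of some [a] can be
   added to [S], or every outside neighbour has degree at most 3; then [Z] splits
   into at least two classes according to the outside neighbour, which forces all
   of [Z] to miss the same vertex [z] of [S], and [z] is expensive to keep. *)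
Lemma removable_or_gain U v :
  {in U, forall u, deg U u <= n - 3} -> v \in U -> deg U v = n - 3 ->
  (exists S, removable U S) \/
  \sum_(a in cnbr U v) cost U (cnbr U v) a + (n - 6) <= (n - 2) * (n - 2).
Proof.
move=> dU vU dv; have SU := cnbr_sub vU; set S := cnbr U v in SU *.
have cS : #|S| = n - 2 by rewrite card_cnbr; lia.
have vS : v \in S by apply: setU11.
(* By [free_out] a vertex of [S] of degree at least 4 has at most one neighbour outside [S], so [Z]
   consists of the vertices whose cost reaches n - 2. *)
pose Z := [set a in S | (deg U a == n - 3) && (deg (U :\: S) a == 1)].
have outv : deg (U :\: S) v = 0 by apply: out_center.
have vZ : v \notin Z by rewrite inE outv /= !andbF.
have ZP a : a \in Z -> [/\ a \in S, a \in U, e v a, deg U a = n - 3 & deg (U :\: S) a = 1].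
  move=> aZ; have := aZ; rewrite inE => /and3P[aS /eqP da /eqP oa].
  have [av|[aU va]] := cnbrP aS; first by rewrite -av aZ in vZ.
  by split.
have costS a : a \in S -> cost U S a + (a \notin Z) <= n - 2.
  move=> aS; have [->|[aU va]] := cnbrP aS; first by rewrite /cost outv vZ; lia.
  case: (leqP 4 (deg U a)) => da; last first.
    by have := cost_low SU vS va; rewrite /cost; case: (a \in Z); lia.
  have := free_out vU aU va; have := dU _ aU.
  rewrite inE aS /cost -/S /=.
  by case: eqP; case: eqP => /=; clear -n_ge da dv; lia.
case: (boolP [exists a in Z, [exists b in nbr (U :\: S) a, 4 <= deg U b]]).
  case/exists_inP=> a aZ /exists_inP[b]; rewrite !inE => /andP[/andP[bS bU] ab] db.
  have [aS aU va da oa] := ZP _ aZ.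
  have outa : nbr (U :\: S) a = [set b].
    apply/esym/eqP; rewrite eqEcard sub1set cards1 -/(deg _ a) oa andbT.
    by rewrite !inE bS bU ab.
  have bSn : b \notin S by rewrite !inE.
  left; exists (b |: S); split.
  - by rewrite subUset sub1set bU.
  - by rewrite cardsU1 bSn cS; clear -n_ge; lia.
  have <- : #|b |: S| = n - 1 by rewrite cardsU1 bSn cS; clear -n_ge; lia.
  rewrite -sum_nat_const; apply: leq_sum => c; rewrite in_setU1 => /orP[/eqP->|cS'].
    (* Since [b] is the only neighbour of [a] outside [S], the closed neighbourhood of [a] lies in
       [b |: S], and [free_out] at [a] bounds the cost of [b] by n - 2. *)
    have := free_out aU bU ab; rewrite da => /(_ _ db).
    have : deg (U :\: (b |: S)) b <= deg (U :\: cnbr U a) b.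
      apply: deg_sub; apply: setDS; apply/subsetP=> w.
      rewrite in_setU1 => /cnbrP[->|[wU aw]]; first by rewrite aS orbT.
      case: (boolP (w \in S)) => wS; first by rewrite orbT.
      by rewrite orbF -in_set1 -outa in_nbr in_setD wS wU.
    have := dU _ bU; rewrite /cost; clear -n_ge; lia.
  have := costS _ cS'.
  have : deg (U :\: (b |: S)) c <= deg (U :\: S) c.
    by apply: deg_sub; apply: setDS; apply: subsetUr.
  by rewrite /cost; clear -n_ge; lia.
rewrite negb_exists_in => /forall_inP noB; right.
have low a b : a \in Z -> b \in nbr (U :\: S) a -> deg U b <= 3.
  by move=> /noB; rewrite negb_exists_in => /forall_inP H /H; clear; lia.
(* With at most four vertices in [Z], at least n - 6 vertices of [S] save one each. *)
case: (leqP #|Z| 4) => cZ.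
  have := sum_cost_le costS; have := subset_leq_card (subsetIr S Z).
  by rewrite cardsD cS; clear -n_ge cZ; nia.
(* A member of [Z] has n - 4 neighbours among the n - 3 other vertices of [S], hence misses exactly
   one. *)
pose nonN a := [set w in S | (w != a) && ~~ e a w].
have nonN1 a : a \in Z -> exists z, nonN a = [set z].
  move=> aZ; have [aS aU va da oa] := ZP _ aZ; apply/cards1P.
  have := cardsD1 a S; rewrite aS cS.
  have -> : #|S :\ a| = deg S a + #|nonN a|.
    rewrite /deg -cardsUI.
    have -> : nbr S a :&: nonN a = set0.
      by apply/setP=> w; rewrite !inE; case: (e a w); rewrite !andbF.
    rewrite cards0 addn0; congr #|pred_of_set _|; apply/setP=> w.
    rewrite !inE.
    have [->|wa] := eqVneq w a; first by rewrite e_irr /= !andbF.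
    by case: (w == v); case: (w \in U); case: (e v w); case: (e a w).
  by have := degD a SU; rewrite da oa; clear -n_ge; lia.
(* If [a] and [c] are adjacent and miss different vertices, then [c] has two neighbours outside the
   closed neighbourhood of [a]: its own outside neighbour and the vertex missed by [a]. But
   [free_out] at [a] permits only one. *)
have claim a c : a \in Z -> c \in Z -> nbr (U :\: S) a != nbr (U :\: S) c ->
    c \in nonN a \/ nonN a = nonN c.
  move=> aZ cZ' neq; have [aS aU va da oa] := ZP _ aZ.
  have [cS' cU vc dc oc] := ZP _ cZ'.
  case: (boolP (c \in nonN a)) => [|cn]; [by left | right].
  have ca : c != a by apply: contraNneq neq => ->.
  have ac : e a c by move: cn; rewrite inE cS' ca /= negbK.
  have /eqP/cards1P[y oy] := oc; have /eqP/cards1P[b ob] := oa.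
  have [z za] := nonN1 _ aZ; have [z' zc] := nonN1 _ cZ'.
  have : z \in nonN a by rewrite za set11.
  rewrite inE => /and3P[zS zna zea].
  have zca : z != c by apply: contraNneq zea => ->.
  have yoc : y \in nbr (U :\: S) c by rewrite oy set11.
  have /andP[/andP[yS yU] cy] : ((y \notin S) && (y \in U)) && e c y by move: yoc; rewrite in_nbr in_setD.
  case: (boolP (e c z)) => cz; last first.
    have : z \in nonN c by rewrite inE zS zca cz.
    by rewrite za zc inE => /eqP->.
  have ya : ~~ e a y.
    apply: contraNN neq => ay; have : y \in nbr (U :\: S) a by rewrite in_nbr in_setD yS yU.
    by rewrite oy ob inE => /eqP->.
  have : #|[set y; z]| <= deg (U :\: cnbr U a) c.
    apply: subset_leq_card; apply/subsetP=> w.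
    have yna : y != a by apply: contraNneq yS => ->.
    rewrite 3!inE in_nbr => /orP[] /eqP->; rewrite in_setD /cnbr in_setU1 in_nbr.
      by rewrite (negPf ya) (negPf yna) andbF cy yU.
    by rewrite (negPf zea) (negPf zna) andbF cz (subsetP SU).
  have yz : y != z by apply: contraNneq yS => ->.
  by rewrite cards2 yz; have := free_out aU cU ac; clear -n_ge da dc; lia.
have nonN_sym a c : a \in Z -> c \in Z -> c \in nonN a -> a \in nonN c.
  move=> aZ _; have [aS _ _ _ _] := ZP _ aZ.
  rewrite inE => /and3P[_ ca ac].
  by rewrite inE aS eq_sym ca e_sym ac.
(* An outside neighbour has degree at most 3, so at most three members of [Z] share that of [a], and
   at least two of the five or more differ. *)
have other a : a \in Z -> exists2 B : {set V}, 1 < #|B| &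
    {in B, forall c, c \in Z /\ nbr (U :\: S) a != nbr (U :\: S) c}.
  move=> aZ; exists (Z :\: [set c | nbr (U :\: S) a == nbr (U :\: S) c]); last first.
    by move=> c; rewrite 2!inE => /andP[].
  have [aS aU va da oa] := ZP _ aZ; have /eqP/cards1P[b ob] := oa.
  have boa : b \in nbr (U :\: S) a by rewrite ob set11.
  suff : #|Z :&: [set c | nbr (U :\: S) a == nbr (U :\: S) c]| <= 3 by rewrite cardsD; clear -cZ; lia.
  apply: leq_trans (low _ _ aZ boa); apply: subset_leq_card; apply/subsetP => c.
  rewrite in_setI in_set in_nbr => /andP[cZ' /eqP E].
  by have [_ -> _ _ _] := ZP _ cZ'; move: boa; rewrite E in_nbr e_sym => /andP[].
(* Were [c] missed by [a], it would be missed by a further [c2] too, and by symmetry [c] would miss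
   both [a] and [c2]. *)
have diff a c : a \in Z -> c \in Z -> nbr (U :\: S) a != nbr (U :\: S) c -> nonN a = nonN c.
  move=> aZ cZ' neq; have [cn|//] := claim _ _ aZ cZ' neq; exfalso.
  have [B B1 HB] := other _ aZ.
  have /card_gt0P[c2] : 0 < #|B :\ c| by have := cardsD1 c B; clear -B1; lia.
  rewrite in_setD1 => /andP[c2c /HB [c2Z neq2]].
  have [z za] := nonN1 _ aZ; have [z' zc] := nonN1 _ cZ'.
  have zc' : c = z by apply/eqP; rewrite -in_set1 -za.
  have [|E] := claim _ _ aZ c2Z neq2.
    by rewrite za inE -zc' (negPf c2c).
  have : c \in nonN c2 by rewrite -E.
  move/(nonN_sym _ _ c2Z cZ'); have := nonN_sym _ _ aZ cZ' cn.
  rewrite zc !inE => /eqP Ea /eqP Ec2.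
  by rewrite Ea Ec2 eqxx in neq2.
have same a c : a \in Z -> c \in Z -> nonN a = nonN c.
  move=> aZ cZ'; have [B B1 HB] := other _ aZ.
  have /card_gt0P[d dB] : 0 < #|B| by clear -B1; lia.
  have [dZ neq] := HB _ dB; rewrite (diff a d) //.
  case: (eqVneq (nbr (U :\: S) c) (nbr (U :\: S) d)) => E; last by rewrite (diff c d).
  case: (eqVneq (nbr (U :\: S) a) (nbr (U :\: S) c)) => E2; first by rewrite E2 E eqxx in neq.
  by rewrite -(diff a d) // (diff a c).
have /card_gt0P[a aZ] : 0 < #|Z| by clear -cZ; lia.
have [z za] := nonN1 _ aZ; have [aS aU va da oa] := ZP _ aZ.
have : z \in nonN a by rewrite za set11.
rewrite inE => /and3P[zS zna zea].
have zZ : z \notin Z.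
  by apply/negP => zZ; have := set11 z; rewrite -za (same a z) // inE eqxx andbF.
have [zv|[zU vz]] := cnbrP zS; first by rewrite zv e_sym va in zea.
(* The vertex [z], its neighbours in [S] and [Z] are disjoint parts of [S]. So a large [Z], which
   weakens the saving elsewhere, makes [z] itself cheap. *)
have dz : deg S z + #|Z| + 1 <= n - 2.
  have -> : deg S z + #|Z| + 1 = #|z |: (nbr S z :|: Z)|.
    rewrite cardsU1 inE negb_or zZ in_nbr e_irr andbF /= cardsU.
    suff -> : nbr S z :&: Z = set0 by rewrite cards0 /deg; clear; lia.
    apply/setP=> c; rewrite in_setI in_set0 in_nbr; apply/negP => /andP[/andP[_ zc] cZ'].
    have : z \in nonN c by rewrite -(same a) // za set11.
    by rewrite inE e_sym zc !andbF.
  rewrite -cS; apply: subset_leq_card; rewrite subUset sub1set zS subUset /=.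
  by apply/andP; split; apply/subsetP=> w; rewrite inE => /andP[].
have cz : cost U S z <= 5 \/ cost U S z + #|Z| <= n - 1.
  case: (leqP 4 (deg U z)) => dz4; last by left; apply: (cost_low SU vS).
  right; have := free_out vU zU vz; have := degD z SU; rewrite -/S /cost; clear -dv dz dz4 n_ge; lia.
have costz : {in S :\ z, forall c, cost U S c + (c \notin Z) <= n - 2}.
  by move=> c; rewrite in_setD1 => /andP[_ /costS].
have := sum_cost_le costz.
have cSz : #|S :\ z| = n - 3 by have := cardsD1 z S; rewrite zS cS; clear -n_ge; lia.
have ZSz : Z \subset S :\ z.
  apply/subsetP=> c cZ'; have [cS' _ _ _ _] := ZP _ cZ'; rewrite in_setD1 cS' andbT.
  by apply: contraNneq zZ => <-.
have := subset_leq_card ZSz; rewrite (cardsDS ZSz) cSz (big_setD1 z zS) /=.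
have : (n - 2) * (n - 2) = (n - 3) * (n - 2) + (n - 2) by clear -n_ge; nia.
have : 0 < deg S z by apply: (deg_pos vS); rewrite e_sym.
by clear -n_ge cz cZ dz; lia.
Qed.

(** * Defects along a residue class of the number of vertices *)

Definition defect U k := sumdeg U + k <= (n - 2) * #|U|.

Lemma defectW U k l : l <= k -> defect U k -> defect U l.
Proof. by rewrite /defect; lia. Qed.

Lemma defect_remove U S k l : S \subset U ->
  \sum_(a in S) cost U S a + l <= (n - 2) * #|S| ->
  defect (U :\: S) k -> defect U (k + l).
Proof.
move=> SU; have := sumdeg_remove SU; rewrite /defect /cost -(cardsID S U) (setIidPr SU) mulnDr.
by clear; lia.
Qed.

Lemma defect_deg U d :
  d <= n - 2 -> {in U, forall v, deg U v <= n - 2 - d} -> defect U (d * #|U|).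
Proof.
move=> dn dU; rewrite /defect.
have : sumdeg U <= #|U| * (n - 2 - d) by rewrite -sum_nat_const; apply: leq_sum.
have : (n - 2) * #|U| = #|U| * (n - 2 - d) + d * #|U|.
  by rewrite -{1}(subnK dn) mulnDl [_ * #|U|]mulnC.
by clear; lia.
Qed.

Lemma defect_small U : #|U| <= n - 1 -> defect U ((n - 1 - #|U|) * #|U|).
Proof.
(* For empty [U] the factor is n - 1, beyond the range of [defect_deg]. *)
move=> cU; case: (posnP #|U|) => U0.
  by have := sumdeg_le U; rewrite /defect U0 !muln0 addn0.
apply: defect_deg => [|v vU]; first by move: n_ge; clear -U0; lia.
by have := deg_lt_card vU; clear -n_ge cU U0; lia.
Qed.

Definition defect_class r k := forall q U, #|U| = q * (n - 1) + r -> defect U k.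

(** Deleting a removable set lowers [q] by one; for q = 0 none fits, because r < n - 1. *)
Lemma defect_class_ind r k : r < n - 1 ->
  (forall q U, #|U| = q * (n - 1) + r -> (exists S, removable U S) \/ defect U k) ->
  defect_class r k.
Proof.
move=> rn IH; elim=> [|q IHq] U cU; have [[S [SU cS sS]]|//] := IH _ _ cU.
  by have := subset_leq_card SU; rewrite cU cS leqNgt mul0n add0n rn.
rewrite -[k]addn0; apply: (defect_remove SU).
  by rewrite cS addn0 mulnC.
by apply: IHq; rewrite cardsDS // cU cS mulSn; clear; move: (q * _) => N; lia.
Qed.

Lemma removable_or_deg U :
  (exists S, removable U S) \/ {in U, forall v, deg U v <= n - 3}.
Proof.
case: (boolP [exists v in U, n - 2 <= deg U v]) => [/exists_inP[v vU dv]|].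
  by left; apply: exists_removable dv.
rewrite negb_exists_in => /forall_inP H; right=> v /H.
by clear -n_ge; lia.
Qed.

(** Without a removable set, a vertex of degree n - 3 has a closed neighbourhood of n - 2 vertices
    carrying a defect of n - 6. What remains has (q - 1)(n - 1) + r + 1 vertices, where q > 0 since
    r < n - 2. *)
Lemma defect_class_step r k l : r < n - 2 -> k <= l + (n - 6) -> defect_class r.+1 l ->
  (forall q U, #|U| = q * (n - 1) + r -> {in U, forall v, deg U v <= n - 4} ->
     defect U k) ->
  defect_class r k.
Proof.
move=> rn kl Hl H; apply: defect_class_ind => [|q U cU]; first by clear -n_ge rn; lia.
have [|dU] := removable_or_deg U; first by left.
case: (boolP [exists v in U, deg U v == n - 3]) => [/exists_inP[v vU /eqP dv]|]; last first.
  rewrite negb_exists_in => /forall_inP H'; right; apply: (H q) => // v vU.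
  by have := H' _ vU; have := dU _ vU; clear -n_ge; lia.
have [|sS] := removable_or_gain dU vU dv; first by left.
right; have cS : #|cnbr U v| = n - 2 by rewrite card_cnbr dv; clear -n_ge; lia.
apply: (defectW kl); apply: (@defect_remove U (cnbr U v)); rewrite ?cS //.
  exact: cnbr_sub.
apply: (Hl q.-1); rewrite cardsDS ?cnbr_sub // cS cU.
have := deg_lt_card vU; rewrite cU dv; case: q {cU} => [|q]; rewrite ?mulSn /=.
  by clear -n_ge rn; lia.
by clear -n_ge rn; move: (q * _) => N; lia.
Qed.

Lemma sumdeg_low (B : {set V}) b d : b \in B -> deg B b <= d ->
  sumdeg B <= #|B|.-1 * #|B|.-2 + d.*2.
Proof.
move=> bB db; have sb : [set b] \subset B by rewrite sub1set.
rewrite (sumdeg_remove sb) big_set1.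
have := sumdeg_le (B :\ b); have := deg_sub b (subsetDl B [set b]).
have -> : #|B :\ b| = #|B|.-1 by have := cardsD1 b B; rewrite bB; lia.
by clear -db; lia.
Qed.

(** * Maximum degree n - 4 on 2n - 8 and 2n - 9 vertices *)

Section NearRegular.
Variables (U : {set V}) (v : V).
Hypotheses (dU : {in U, forall u, deg U u <= n - 4}) (vU : v \in U) (dv : deg U v = n - 4).
Let S := cnbr U v.
Let B := U :\: S.

Lemma nreg_out a : a \in S -> deg B a <= 2.
Proof.
case/cnbrP => [->|[aU va]]; first by rewrite /B out_center.
by apply: free_out2; rewrite ?dv.
Qed.

Lemma nreg_cost a : a \in S -> cost U S a <= n - 2.
Proof.
move=> aS; have aU := subsetP (cnbr_sub vU) _ aS.
by have := nreg_out aS; have := dU aU; rewrite /cost -/B; clear -n_ge; lia.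
Qed.

(** A neighbour of [b] in [B] is either not adjacent to [a], which allows at most two by [free_out2]
    at [a], or the only possible other neighbour of [a] in [B]. *)
Lemma nreg_low a b : a \in S -> deg U a = n - 4 -> b \in B -> e a b -> deg B b <= 3.
Proof.
move=> aS da bB ab; have aU := subsetP (cnbr_sub vU) _ aS.
have bU : b \in U by move: bB; rewrite inE => /andP[].
have o2 : deg (U :\: cnbr U a) b <= 2 by apply: free_out2; rewrite ?da.
have c1 : #|nbr B a :\ b| <= 1.
  by have := cardsD1 b (nbr B a); have := nreg_out aS; rewrite in_nbr bB ab /deg; lia.
have : deg B b <= #|nbr (U :\: cnbr U a) b :|: (nbr B a :\ b)|.
  apply: subset_leq_card; apply/subsetP => w; rewrite in_nbr => /andP[wB bw].
  have wU : w \in U by move: wB; rewrite inE => /andP[].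
  have wa : w != a by apply: contraTneq wB => ->; rewrite inE aS.
  have wb : w != b by apply: contraTneq bw => ->; rewrite e_irr.
  rewrite in_setU in_setD1 !in_nbr in_setD /cnbr in_setU1 in_nbr.
  by rewrite wU bw wB (negPf wa) wb; case: (e a w).
by rewrite cardsU; move: o2; rewrite /deg; clear -c1; lia.
Qed.

Lemma nreg_card : #|S| = n - 3.
Proof. by rewrite card_cnbr dv; clear -n_ge; lia. Qed.

Lemma nreg_sumdeg : sumdeg U = sumdeg B + \sum_(a in S) cost U S a.
Proof. exact/sumdeg_remove/cnbr_sub. Qed.

(** If some vertex of [S] of degree n - 4 has a neighbour in [B], that neighbour has degree at most
    3 in [B]. Otherwise degree n - 4 means no edge to [B], and the other vertices have degree at
    most n - 5 and at most two edges to [B]. *)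
Lemma nreg_dichotomy :
  sumdeg B <= #|B|.-1 * #|B|.-2 + 6 \/
  {in S, forall a, cost U S a + (deg U a == n - 4) <= n - 3}.
Proof.
case: (boolP [exists a in S, (deg U a == n - 4) && (0 < deg B a)]).
  case/exists_inP => a aS /andP[/eqP da /card_gt0P[b]].
  by rewrite in_nbr => /andP[bB ab]; left; apply: (sumdeg_low bB (nreg_low aS da bB ab)).
rewrite negb_exists_in => /forall_inP H; right=> a aS.
have aU := subsetP (cnbr_sub vU) _ aS.
have := H _ aS; have := dU aU; have := nreg_out aS.
rewrite /cost -/B; clear -n_ge; case: eqP => /=; lia.
Qed.

End NearRegular.

(** A vertex of degree n - 4 leaves n - 5 vertices in the rest, and the two cases of
    [nreg_dichotomy] give the defects 6n - 38 and 5n - 23; the first suffices exactly because n is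
    at least 15. *)
Lemma defect_near6 U : #|U| = 2 * n - 8 -> {in U, forall u, deg U u <= n - 4} ->
  defect U (5 * n - 23).
Proof.
move=> cU dU; have [m nE] : exists m, n = m + 15 by exists (n - 15); clear -n_ge; lia.
case: (boolP [exists v in U, deg U v == n - 4]) => [/exists_inP[v vU /eqP dv]|]; last first.
  rewrite negb_exists_in => /forall_inP H; apply: (@defectW U (3 * #|U|)).
    by rewrite cU; clear -n_ge; lia.
  apply: defect_deg => [|u uU]; first by clear -n_ge; lia.
  by have := H _ uU; have := dU _ uU; clear -n_ge; lia.
have cS := nreg_card dv.
have cB : #|U :\: cnbr U v| = m + 10.
  by rewrite cardsDS ?cnbr_sub // cS cU nE; clear; lia.
rewrite /defect (nreg_sumdeg vU) cU.
have -> : 2 * n - 8 = 2 * m + 22 by rewrite nE; clear; lia.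
have -> : 5 * n - 23 = 5 * m + 52 by rewrite nE; clear; lia.
have e2 : n - 2 = m + 13 by rewrite nE; clear; lia.
have e3 : n - 3 = m + 12 by rewrite nE; clear; lia.
have [sB | sS] := nreg_dichotomy dU vU dv.
  have : \sum_(a in cnbr U v) cost U (cnbr U v) a <= #|cnbr U v| * (n - 2).
    by rewrite -sum_nat_const; apply: leq_sum => a; apply: nreg_cost.
  move: sB; rewrite cS cB e2 e3 !addnS /=; clear; lia.
have : \sum_(a in cnbr U v) cost U (cnbr U v) a <= #|cnbr U v| * (n - 3).
  by rewrite -sum_nat_const; apply: leq_sum => a /sS; clear; lia.
by have := sumdeg_le (U :\: cnbr U v); rewrite cS cB e2 e3 addnS /=; clear; lia.
Qed.

(** The first case of [nreg_dichotomy] gives 7n - 50. The second gives only 6n - 33 plus the number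
    of vertices of degree n - 4 in [S], at least one, so up to two more units have to be found. *)
Lemma defect_near7 U : #|U| = 2 * n - 9 -> {in U, forall u, deg U u <= n - 4} ->
  defect U (minn (7 * n - 56) (6 * n - 30)).
Proof.
move=> cU dU; have [m nE] : exists m, n = m + 15 by exists (n - 15); clear -n_ge; lia.
case: (boolP [exists v in U, deg U v == n - 4]) => [/exists_inP[v vU /eqP dv]|]; last first.
  rewrite negb_exists_in => /forall_inP H; apply: (@defectW U (3 * #|U|)).
    by rewrite cU; clear -n_ge; lia.
  apply: defect_deg => [|u uU]; first by clear -n_ge; lia.
  by have := H _ uU; have := dU _ uU; clear -n_ge; lia.
have SU := cnbr_sub vU; have cS := nreg_card dv.
have cost2 := nreg_cost dU vU dv; have out2 := nreg_out vU dv.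
have dich := nreg_dichotomy dU vU dv; have sdU := nreg_sumdeg vU.
have vS := setU11 v (nbr U v).
rewrite -/(cnbr U v) in vS; set S := cnbr U v in SU cS cost2 out2 dich sdU vS.
set B := U :\: S in out2 dich sdU.
have cB : #|B| = m + 9 by rewrite cardsDS // cS cU nE; clear; lia.
have e7 : minn (7 * n - 56) (6 * n - 30) <= 7 * m + 49 by rewrite nE; clear; lia.
have e6 : minn (7 * n - 56) (6 * n - 30) <= 6 * m + 60 by rewrite nE; clear; lia.
have e2 : n - 2 = m + 13 by rewrite nE; clear; lia.
have e3 : n - 3 = m + 12 by rewrite nE; clear; lia.
have eU : #|U| = 2 * m + 21 by rewrite cU nE; clear; lia.
have sB0 := sumdeg_le B; rewrite cB addnS /= in sB0.
case: dich => [sB | costS].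
  apply: (defectW e7); rewrite /defect sdU eU.
  have : \sum_(a in S) cost U S a <= #|S| * (n - 2).
    by rewrite -sum_nat_const; apply: leq_sum.
  by move: sB; rewrite cS cB e2 e3 !addnS /=; clear; lia.
apply: (defectW e6); rewrite /defect eU e2.
pose H := [set a in S | deg U a == n - 4].
have sH : \sum_(a in S) cost U S a + #|H| <= #|S| * (n - 3).
  have -> : #|H| = \sum_(a in S) (deg U a == n - 4).
    by rewrite -sum1dep_card big_mkcondr; apply: eq_bigr => a _; case: eqP.
  by rewrite -big_split -sum_nat_const; apply: leq_sum => a /costS.
have vH : v \in H by rewrite inE vS dv eqxx.
have H0 : 0 < #|H| by apply/card_gt0P; exists v.
rewrite cS e3 in sH.
case: (boolP [exists h in B, deg U h == n - 4]) => [/exists_inP[h hB /eqP dh]|].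
  have hU : h \in U by move: hB; rewrite inE => /andP[].
  have hS : h \notin S by move: hB; rewrite inE => /andP[].
  have dhS := degD h SU; rewrite -/B dh in dhS.
  have sB := sumdeg_low hB (leqnn _); have dB := deg_lt_card hB.
  rewrite cB !addnS /= in sB dB.
  (* At most n - 7 neighbours of [h] lie in [B], so at least three lie in [S]. With four or more,
     [sumdeg B] is at least two below that of a clique. *)
  case: (leqP 4 (deg S h)) => t4.
    rewrite sdU; move: sB sH dhS; rewrite nE; clear -t4 H0; lia.
  have dSh : deg S h = 3 by move: dhS dB t4; rewrite nE; clear; lia.
  have /card_gt0P[a] : 0 < #|nbr S h| by rewrite -/(deg S h) dSh.
  rewrite in_nbr => /andP[aS ha]; have aU := subsetP SU _ aS.
  have o1 : deg (U :\: cnbr U h) a <= 2 by apply: free_out2; rewrite ?dh.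
  have o2 : deg (cnbr U h) a <= #|nbr B a :|: (nbr S h :\ a)|.
    apply: subset_leq_card; apply/subsetP => w; rewrite in_nbr => /andP[wh aw].
    have wa : w != a by apply: contraTneq aw => ->; rewrite e_irr.
    rewrite in_setU in_setD1 !in_nbr wa aw in_setD.
    have [->|[wU ->]] := cnbrP wh; first by rewrite hS hU.
    by rewrite wU; case: (w \in S).
  have c2 : #|nbr S h :\ a| = 2.
    have := cardsD1 a (nbr S h); rewrite in_nbr aS ha -/(deg S h) dSh.
    by clear; lia.
  (* At most two neighbours of [a] lie outside the closed neighbourhood of [h]; inside it, at most
     two lie in [B] and two in [S]. So [a] has degree at most 6. *)
  have ca : cost U S a <= 8.
    have := out2 _ aS; have := degD a (cnbr_sub hU).
    move: o2; rewrite cardsU c2 /cost -/B -/(deg B a); clear -o1; lia.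
  have sSa : \sum_(c in S :\ a) cost U S c <= #|S :\ a| * (n - 3).
    rewrite -sum_nat_const; apply: leq_sum => c; rewrite in_setD1 => /andP[_ /costS].
    by clear; lia.
  have cSa : #|S :\ a| = m + 11.
    by have := cardsD1 a S; rewrite aS cS e3; clear; lia.
  rewrite sdU (big_setD1 a aS) /=; move: sSa sB dhS; rewrite cSa e3 dSh nE.
  by clear -ca; lia.
(* Now [H] holds every vertex of degree n - 4. Three of them close the gap; with at most two, the
   degree sum is at most (n - 5)|U| + 2. *)
rewrite negb_exists_in => /forall_inP noH.
case: (leqP 3 #|H|) => H3; first by rewrite sdU; clear -H3 sH sB0; lia.
have : sumdeg U <= #|U| * (n - 5) + #|H|.
  have -> : #|H| = \sum_(a in U) (deg U a == n - 4).
    rewrite -sum1dep_card (big_setID S) /= (setIidPr SU) big_mkcondr /=.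
    rewrite [X in _ + X]big1 ?addn0; last by move=> a /noH /negPf ->.
    by apply: eq_bigr => a _; case: eqP.
  rewrite -sum_nat_const -big_split; apply: leq_sum => a /dU /=.
  by case: eqP; rewrite nE; clear; lia.
have -> : n - 5 = m + 10 by rewrite nE; clear; lia.
by rewrite eU; clear -H3; lia.
Qed.

(** The index is n - 1 minus the residue. The chain can start here because degrees at most n - 3
    already give the defect |U|, which is at least 2n - 5 once q > 0. *)
Lemma defect_class3 : defect_class (n - 4) (2 * n - 5).
Proof.
apply: defect_class_ind => [|q U cU]; first by clear -n_ge; lia.
have [|dU] := removable_or_deg U; [by left | right].
case: q cU => [|q] cU.
  apply: defectW (defect_small _); rewrite cU; last by clear -n_ge; lia.
  by have -> : n - 1 - (0 * (n - 1) + (n - 4)) = 3; clear -n_ge; lia.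
apply: (@defectW U (1 * #|U|)); last first.
  apply: defect_deg => [|u /dU]; clear -n_ge; lia.
by rewrite mul1n cU (mulSn q); move: (q * _) => N; clear -n_ge; lia.
Qed.

Lemma defect_deg2 U : {in U, forall v, deg U v <= n - 4} -> defect U (2 * #|U|).
Proof. by move=> dU; apply: defect_deg => [|v /dU]; clear -n_ge; lia. Qed.

Lemma defect_class4 : defect_class (n - 5) (3 * n - 11).
Proof.
have := defect_class3; rewrite (_ : n - 4 = (n - 5).+1); last by clear -n_ge; lia.
move=> prev; apply: (defect_class_step _ _ prev) => [||q U cU dU];
  [by clear -n_ge; lia | by clear -n_ge; lia |].
case: q cU => [|q] cU.
  apply: defectW (defect_small _); rewrite cU; last by clear -n_ge; lia.
  by rewrite (_ : n - 1 - (0 * (n - 1) + (n - 5)) = 4); clear -n_ge; lia.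
apply: defectW (defect_deg2 dU); rewrite cU (mulSn q).
by move: (q * _) => N; clear -n_ge; lia.
Qed.

Lemma defect_class5 : defect_class (n - 6) (4 * n - 17).
Proof.
have := defect_class4; rewrite (_ : n - 5 = (n - 6).+1); last by clear -n_ge; lia.
move=> prev; apply: (defect_class_step _ _ prev) => [||q U cU dU];
  [by clear -n_ge; lia | by clear -n_ge; lia |].
case: q cU => [|q] cU.
  apply: defectW (defect_small _); rewrite cU; last by clear -n_ge; lia.
  by rewrite (_ : n - 1 - (0 * (n - 1) + (n - 6)) = 5); clear -n_ge; lia.
apply: defectW (defect_deg2 dU); rewrite cU (mulSn q).
by move: (q * _) => N; clear -n_ge; lia.
Qed.

(** The value 6n - 50 is chosen so that the n - 6 gained in the next step lead to 7n - 56. For q = 1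
    the bound 2|U| is too weak and [defect_near6] takes over. *)
Lemma defect_class6 : defect_class (n - 7) (minn (6 * n - 50) (5 * n - 23)).
Proof.
have := defect_class5; rewrite (_ : n - 6 = (n - 7).+1); last by clear -n_ge; lia.
move=> prev; apply: (defect_class_step _ _ prev) => [||q U cU dU];
  [by clear -n_ge; lia | by clear -n_ge; lia |].
case: q cU => [|[|q]] cU.
- apply: defectW (defect_small _); rewrite cU; last by clear -n_ge; lia.
  by rewrite (_ : n - 1 - (0 * (n - 1) + (n - 7)) = 6); clear -n_ge; lia.
- apply: defectW (geq_minr _ _) (defect_near6 _ dU).
  by rewrite cU; clear -n_ge; lia.
apply: defectW (defect_deg2 dU); rewrite cU (mulSn q.+1) (mulSn q).
by move: (q * _) => N; clear -n_ge; lia.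
Qed.

(** The two values are the defects of the extremal graphs: 7(n - 8) for [K_(n-8)] and, up to parity,
    6n - 30 for the other. *)
Lemma defect_class7 : defect_class (n - 8) (minn (7 * n - 56) (6 * n - 30)).
Proof.
have := defect_class6; rewrite (_ : n - 7 = (n - 8).+1); last by clear -n_ge; lia.
move=> prev; apply: (defect_class_step _ _ prev) => [||q U cU dU];
  [by clear -n_ge; lia | by clear -n_ge; lia |].
case: q cU => [|[|q]] cU.
- apply: defectW (defect_small _); rewrite cU; last by clear -n_ge; lia.
  by rewrite (_ : n - 1 - (0 * (n - 1) + (n - 8)) = 7); clear -n_ge; lia.
- by apply: (defect_near7 _ dU); rewrite cU; clear -n_ge; lia.
apply: defectW (defect_deg2 dU); rewrite cU (mulSn q.+1) (mulSn q).
by move: (q * _) => N; clear -n_ge; lia.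
Qed.

End Free.

End Graph.

(** * Graphs as relations *)

Definition adj (p : nat) (G : sgraph p) : rel 'I_p :=
  [rel u v | (u != v) && ([set u; v] \in G)].

Lemma adjE p (G : sgraph p) u v : adj G u v = (u != v) && ([set u; v] \in G).
Proof. by []. Qed.

Lemma adj_sym p (G : sgraph p) : symmetric (adj G).
Proof. by move=> u v; rewrite !adjE eq_sym setUC. Qed.

Lemma adj_irr p (G : sgraph p) : irreflexive (adj G).
Proof. by move=> u; rewrite adjE eqxx. Qed.

Lemma sumdeg_adj p (G : sgraph p) : is_simple G -> sumdeg (adj G) setT = 2 * #|G|.
Proof.
move=> /forall_inP simG.
have degG v : deg (adj G) setT v = \sum_(x in G) (v \in x).
  have -> : \sum_(x in G) (v \in x) = #|[set x in G | v \in x]|.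
    by rewrite -sum1dep_card big_mkcondr; apply: eq_bigr => x _; case: (v \in x).
  have -> : [set x in G | v \in x] = (fun w => [set v; w]) @: nbr (adj G) setT v.
    apply/setP=> x; rewrite inE; apply/andP/imsetP => [[xG vx]|[w]].
      have /cards2P[a [b [ab xE]]] := simG _ xG.
      move: vx xG; rewrite xE !inE => /orP[] /eqP-> xG.
        by exists b; rewrite // !inE adjE ab xG.
      by exists a; rewrite 1?setUC // !inE adjE eq_sym ab setUC xG.
    by rewrite !inE adjE => /and3P[_ _ vwG] ->; rewrite vwG !inE eqxx.
  rewrite card_in_imset // => w1 w2; rewrite !inE !adjE => /and3P[_ vw1 _] _ E.
  have : w1 \in [set v; w2] by rewrite -E !inE eqxx orbT.
  by rewrite !inE eq_sym (negPf vw1) => /eqP.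
rewrite /sumdeg; under eq_bigr => v _ do rewrite degG.
rewrite exchange_big /= mulnC -sum_nat_const; apply: eq_bigr => x /simG /eqP <-.
by rewrite -sum1_card [RHS]big_mkcond; apply: eq_big => // v; rewrite inE.
Qed.

Lemma card_ord_range n a b : b <= n -> #|[set i : 'I_n | a <= i < b]| = b - a.
Proof.
move=> bn; rewrite -sum1dep_card -(big_mkord (fun i => a <= i < b) (fun=> 1)).
rewrite -(big_nat_widen 0 b n (leq a)) // -(big_nat_widenl a 0 b xpredT) //.
by rewrite sum_nat_const_nat muln1.
Qed.

Lemma contains_Tn3 p n (G : sgraph p) : 6 <= n ->
  contains (Tn3 n) G -> ~ dstar_free (adj G) n.
Proof.
move=> n6 /existsP[f /andP[/injectiveP f_inj /forall_inP fE]] free.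
have n0 : 0 < n by lia.
have n1 : 1 < n by lia.
pose i0 := Ordinal n0; pose i1 := Ordinal n1.
have edge i j : Tn3_adj i j -> adj G (f i) (f j).
  move=> ij; apply/andP; split.
    apply/eqP => /f_inj E; move: ij; rewrite E /Tn3_adj; clear -n6; lia.
  have := fE [set i; j]; rewrite imsetU1 imset_set1; apply.
  by rewrite inE; apply/existsP; exists i; apply/existsP; exists j; rewrite ij eqxx.
pose X := f @: [set i : 'I_n | 2 <= i < n - 3].
pose Y := f @: [set i : 'I_n | n - 3 <= i < n].
suff: [disjoint X & Y].
  apply/negP; apply: (free (f i0) (f i1)).
  - by apply: edge; rewrite /Tn3_adj /=; lia.
  - apply/subsetP => _ /imsetP[i + ->]; rewrite !inE => ri.
    rewrite (inj_eq f_inj); apply/andP; split; first by apply/eqP => E; rewrite E /= in ri.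
    by apply: edge; rewrite /Tn3_adj /=; lia.
  - apply/subsetP => _ /imsetP[i + ->]; rewrite !inE => ri.
    rewrite (inj_eq f_inj); apply/andP; split.
      by apply/eqP => E; rewrite E /= in ri; lia.
    by apply: edge; rewrite /Tn3_adj /=; lia.
  - by rewrite card_imset // card_ord_range; lia.
  - by rewrite card_imset // card_ord_range; lia.
rewrite -setI_eq0; apply/eqP/setP => w; rewrite !inE; apply/negP => /andP[].
case/imsetP => i + -> /imsetP[j + /f_inj ij]; rewrite -ij !inE; clear; lia.
Qed.

Lemma free_Tn3 p n (G : sgraph p) : 6 <= n ->
  ~~ contains (Tn3 n) G -> dstar_free (adj G) n.
Proof.
move=> n6 noT v a X Y va XN YN cX cY; apply: contraNN noT => dis.
(* Positions in this list are the labels in [Tn3]: the centres at 0 and 1, the leaves of [v] at 2 to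
   n - 4, then the three leaves of [a]. *)
pose s := v :: a :: enum X ++ enum Y.
have sX : size (enum X) = n - 5 by rewrite -cardE.
have sY : size (enum Y) = 3 by rewrite -cardE.
have szs : size s = n by rewrite /= size_cat sX sY; lia.
have XP w : w \in X -> [/\ w != a, w != v & adj G v w].
  move=> wX; have := subsetP XN _ wX; rewrite !inE => /and3P[wa _ vw].
  by split=> //; move: vw; rewrite adjE eq_sym => /andP[].
have YP w : w \in Y -> [/\ w != v, w != a & adj G a w].
  move=> wY; have := subsetP YN _ wY; rewrite !inE => /and3P[wv _ aw].
  by split=> //; move: aw; rewrite adjE eq_sym => /andP[].
have us : uniq s.
  have /andP[vna _] := va.
  have vX : v \notin X by apply/negP => /XP[]; rewrite eqxx.
  have vY : v \notin Y by apply/negP => /YP[]; rewrite eqxx.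
  have aX : a \notin X by apply/negP => /XP[]; rewrite eqxx.
  have aY : a \notin Y by apply/negP => /YP[]; rewrite eqxx.
  rewrite /= !inE !mem_cat !mem_enum cat_uniq !enum_uniq !negb_or.
  rewrite vna vX vY aX aY /= andbT.
  rewrite -all_predC; apply/allP => w; rewrite mem_enum => wY /=.
  by rewrite mem_enum (disjointFl dis wY).
apply/existsP; exists [ffun i : 'I_n => nth v s i]; apply/andP; split.
  apply/injectiveP => i j; rewrite !ffunE => /eqP.
  by rewrite nth_uniq ?szs // => /eqP /val_inj.
apply/forall_inP => x; rewrite inE => /existsP[i /existsP[j /andP[ij /eqP ->]]].
rewrite imsetU1 imset_set1 !ffunE.
suff /andP[] : adj G (nth v s i) (nth v s j) by [].
case/orP: ij => /andP[/eqP-> /andP[j1 j2]].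
  case: (nat_of_ord j) j1 j2 => [|[|k]] // _ kn.
  rewrite /= nth_cat sX ifT; last by lia.
  by have [|] := XP (nth v (enum X) k); rewrite // -mem_enum mem_nth // sX; lia.
have -> : nth v s j = nth v (enum Y) (j - (n - 3)).
  rewrite -[s]/([:: v; a] ++ (enum X ++ enum Y)) !nth_cat /= sX ifF; last by lia.
  by rewrite ifF; [congr nth|]; lia.
by have [|] := YP (nth v (enum Y) (j - (n - 3))); rewrite // -mem_enum mem_nth // sY; have := ltn_ord j; lia.
Qed.

Lemma ex_Tn3_upper p n N : 6 <= n ->
  (forall e : rel 'I_p, symmetric e -> irreflexive e -> dstar_free e n ->
     sumdeg e setT <= N) ->
  2 * ex p (Tn3 n) <= N.
Proof.
move=> n6 H; suff : ex p (Tn3 n) <= N./2 by lia.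
apply/bigmax_leqP => G /andP[simG noT].
have := H _ (adj_sym G) (adj_irr G) (free_Tn3 n6 noT).
by rewrite sumdeg_adj //; lia.
Qed.

(** Transport along [enum_val] lets the constructions live on sum and product types instead of
    ordinals. *)
Lemma ex_Tn3_lower (V : finType) (e : rel V) n : 6 <= n ->
  symmetric e -> irreflexive e -> dstar_free e n ->
  sumdeg e setT <= 2 * ex #|V| (Tn3 n).
Proof.
move=> n6 e_sym e_irr e_free.
pose r (i : 'I_#|V|) : V := enum_val i.
have r_inj : injective r by apply: enum_val_inj.
have r_bij : bijective r by exists enum_rank; [exact: enum_valK | exact: enum_rankK].
pose G : sgraph #|V| := [set x | [exists i, exists j, e (r i) (r j) && (x == [set i; j])]].
have adjG i j : adj G i j = e (r i) (r j).
  rewrite adjE; apply/andP/idP => [[ij]|eij].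
    rewrite inE => /existsP[k /existsP[l /andP[kl /eqP E]]].
    have : i \in [set k; l] by rewrite -E !inE eqxx.
    have : j \in [set k; l] by rewrite -E !inE eqxx orbT.
    rewrite !inE => /orP[] /eqP jE /orP[] /eqP iE; move: ij; rewrite jE iE ?eqxx //.
    by rewrite e_sym.
  split; first by apply: contraTneq eij => ->; rewrite e_irr.
  by rewrite inE; apply/existsP; exists i; apply/existsP; exists j; rewrite eij eqxx.
have nbrG i : r @: nbr (adj G) setT i = nbr e setT (r i).
  apply/setP=> w; have [g gK rK] := r_bij; rewrite -[w]rK mem_imset //.
  by rewrite !in_nbr !in_setT adjG.
have sdG : sumdeg (adj G) setT = sumdeg e setT.
  rewrite /sumdeg [RHS](reindex r) /=; last exact: onW_bij.
  apply: eq_big => [i|i _]; first by rewrite !inE.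
  by rewrite /deg -nbrG card_imset.
have simG : is_simple G.
  apply/forall_inP => x; rewrite inE => /existsP[i /existsP[j /andP[eij /eqP->]]].
  by rewrite cards2; have [E|//] := eqVneq i j; rewrite E e_irr in eij.
rewrite -sdG sumdeg_adj // leq_pmul2l //; apply: (@leq_bigmax_cond _ _ (fun G : sgraph _ => #|G|)).
rewrite simG; apply/negP => /(contains_Tn3 n6); apply=> i j X Y ij XN YN cX cY.
have := e_free (r i) (r j) (r @: X) (r @: Y).
rewrite !card_imset // imset_disjoint //.
apply=> //; first by rewrite -adjG.
  apply: subset_trans (imsetS r XN) _; apply/subsetP => _ /imsetP[w wN ->].
  by move: wN; rewrite !inE adjG (inj_eq r_inj).
apply: subset_trans (imsetS r YN) _; apply/subsetP => _ /imsetP[w wN ->].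
by move: wN; rewrite !inE adjG (inj_eq r_inj).
Qed.

(** * Extremal graphs *)

Lemma sum_card (T : finType) (P : pred T) : \sum_x P x = #|[set x | P x]|.
Proof.
by rewrite -sum1dep_card [RHS]big_mkcond; apply: eq_bigr => x _; case: (P x).
Qed.

Lemma sumdegT (V : finType) (e : rel V) : sumdeg e setT = \sum_v \sum_w e v w.
Proof.
apply: eq_big => [v|v _]; first by rewrite inE.
by rewrite degE; apply: eq_bigl => w; rewrite inE.
Qed.

(** * Disjoint unions with copies of [K_(n-1)] *)

Section Blocks.
Variables (W : finType) (eW : rel W) (k n : nat).
Hypotheses (eW_sym : symmetric eW) (eW_irr : irreflexive eW).

Definition blocks : rel (W + 'I_k * 'I_(n - 1)) := fun u v =>
  match u, v with
  | inl a, inl b => eW a b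
  | inr x, inr y => (x.1 == y.1) && (x.2 != y.2)
  | _, _ => false
  end.

Lemma blocks_sym : symmetric blocks.
Proof.
by case=> [a|[i x]] [b|[j y]] //=; rewrite [j == i]eq_sym [y == x]eq_sym.
Qed.

Lemma blocks_irr : irreflexive blocks.
Proof. by case=> [a|[i x]] //=; rewrite !eqxx. Qed.

Lemma sumdeg_blocks : sumdeg blocks setT = sumdeg eW setT + k * (n - 1) * (n - 2).
Proof.
rewrite !sumdegT big_sumType /=; congr (_ + _).
  apply: eq_bigr => a _; rewrite big_sumType /= [X in _ + X]big1 ?addn0 //.
rewrite -[k in RHS]card_ord -[n - 1 in RHS]card_ord -card_prod -sum_nat_const.
apply: eq_bigr => -[i x] _; rewrite big_sumType /= big1 // add0n.
rewrite sum_card (_ : [set _ | _] = setX [set i] [set~ x]).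
  by rewrite cardsX cards1 mul1n cardsC1 card_ord -subnS.
by apply/setP => -[j y]; rewrite !inE /= eq_sym [x == y]eq_sym.
Qed.

(** Both centres lie in one component, and a clique on n - 1 vertices has no room for the n vertices
    of the tree. *)
Lemma blocks_free : 6 <= n -> dstar_free eW n -> dstar_free blocks n.
Proof.
move=> n6 W_free [v|[i x]] [a|[j y]] //= X Y va XN YN cX cY.
  have Xl u : u \in X -> exists2 w, u = inl w & (w != a) && eW v w.
    move/(subsetP XN); rewrite !inE;
    case: u => [w|[j y]] //=.
    by move=> /andP[wa vw]; exists w => //; rewrite vw andbT; apply: contraNneq wa => ->.
  have Yl u : u \in Y -> exists2 w, u = inl w & (w != v) && eW a w.
    move/(subsetP YN); rewrite !inE;
    case: u => [w|[j y]] //=.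
    by move=> /andP[wv aw]; exists w => //; rewrite aw andbT; apply: contraNneq wv => ->.
  pose P (Z : {set W + 'I_k * 'I_(n - 1)}) := [set w : W | inl w \in Z].
  have PE (Z : {set W + 'I_k * 'I_(n - 1)}) : (forall u, u \in Z -> exists w, u = inl w) ->
      Z = inl @: P Z.
    move=> Zl; apply/setP=> u; apply/idP/imsetP => [uZ|[w wP ->]]; last by rewrite inE in wP.
    by have [w E] := Zl _ uZ; exists w; rewrite // inE -E.
  have inl_inj : injective (@inl W ('I_k * 'I_(n - 1))) by move=> ? ? [].
  have XE : X = inl @: P X by apply: PE => u /Xl[w ->]; exists w.
  have YE : Y = inl @: P Y by apply: PE => u /Yl[w ->]; exists w.
  suff: ~~ [disjoint P X & P Y] by rewrite -(imset_disjoint inl_inj) -XE -YE.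
  apply: (W_free v a) => //.
  - by apply/subsetP=> w; rewrite inE => /Xl[w' [<-]]; rewrite !inE.
  - by apply/subsetP=> w; rewrite inE => /Yl[w' [<-]]; rewrite !inE.
  - by rewrite -cX [in RHS]XE card_imset.
  - by rewrite -cY [in RHS]YE card_imset.
apply/negP => dis; case/andP: va => /eqP ij xy.
pose C : {set W + 'I_k * 'I_(n - 1)} := (fun y => inr (i, y)) @: setT.
have cC : #|C| <= n - 1.
  by apply: leq_trans (leq_imset_card _ _) _; rewrite cardsT card_ord.
have XP u : u \in X -> [/\ u \in C, u != inr (i, x) & u != inr (j, y)].
  move/(subsetP XN); rewrite in_setD1 in_nbr in_setT.
  case: u => [w|[l z]] // /and3P[uy _ /andP[/eqP /= il xz]].
  rewrite -il in uy *; split=> //; first exact: imset_f.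
  by apply: contraNneq xz => -[->].
have YP u : u \in Y -> [/\ u \in C, u != inr (i, x) & u != inr (j, y)].
  move/(subsetP YN); rewrite in_setD1 in_nbr in_setT.
  case: u => [w|[l z]] // /and3P[ux _ /andP[/eqP /= jl yz]].
  rewrite -jl -ij in ux *; split=> //; first exact: imset_f.
  by apply: contraNneq yz => -[->].
have : #|[set inr (i, x); inr (j, y)] :|: (X :|: Y)| <= #|C|.
  apply: subset_leq_card; rewrite !subUset !sub1set -ij !imset_f //=.
  by apply/andP; split; apply/subsetP=> u; [case/XP | case/YP].
rewrite cardsU (_ : _ :&: _ = set0); last first.
  apply/setP=> u; rewrite in_setI in_set2 in_setU in_set0; apply/negP.
  by case/andP=> /orP[]/eqP-> /orP[]; [case/XP|case/YP|case/XP|case/YP]; rewrite eqxx.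
rewrite cards0 cards2 cardsU (disjoint_setI0 dis) cards0 cX cY.
have -> : (inr (i, x) : W + 'I_k * 'I_(n - 1)) != inr (j, y).
  by apply: contraNneq xy => -[_ ->].
by move: cC; clear -n6; lia.
Qed.

End Blocks.

(** A converse to [free_out2]: n - 5 leaves at a centre of degree n - 4 exhaust its other
    neighbours, so the leaves at [a] lie outside the closed neighbourhood, where only two are
    available. *)
Lemma free_of_degree (V : finType) (e : rel V) n : symmetric e -> irreflexive e -> 5 <= n ->
  (forall v, deg e setT v <= n - 5 \/
     deg e setT v <= n - 4 /\
     forall a, e v a -> deg e (setT :\: cnbr e setT v) a <= 2) ->
  dstar_free e n.
Proof.
move=> e_sym e_irr n5 H v a X Y va XN YN cX cY; apply/negP => dis.
have av : a \in nbr e setT v by rewrite in_nbr va in_setT.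
have dv : deg e setT v = #|nbr e setT v :\ a|.+1.
  by rewrite /deg (cardsD1 a) av.
have := subset_leq_card XN; rewrite cX => Xdv.
have [|[d4 out2]] := H v; first by rewrite dv; lia.
have XE : X = nbr e setT v :\ a.
  by apply/eqP; rewrite eqEcard XN cX; move: d4; rewrite dv; lia.
have : #|Y| <= deg e (setT :\: cnbr e setT v) a; last by rewrite cY leqNgt ltnS out2.
apply: subset_leq_card; apply/subsetP=> w wY.
have := subsetP YN _ wY; rewrite in_setD1 !in_nbr in_setT /= => /andP[wv aw].
have wa : w != a by apply: contraTneq aw => ->; rewrite e_irr.
rewrite aw andbT in_setD in_setT andbT /cnbr in_setU1 (negPf wv) /=.
by have := disjointFl dis wY; rewrite XE in_setD1 wa /= => ->.
Qed.

(** * The nearly regular graph on 2n - 9 vertices *)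

Section NearRegularGraph.
Variable m : nat.
Hypothesis m_ge : 9 <= m.

(* The vertices are three hubs [inl h], then [A i = inr (inl i)] and
   [B j = inr (inr j)].  The non-edges among the [A i] form a Hamiltonian cycle
   plus the pairs at distance [m./2], and [link] is the 2-regular bipartite graph
   of a cycle of length [2 m]; cyclic distance 1 shows up as 1 or [m.-1]. *)
Definition near (i j : 'I_m) : bool :=
  let d := (i - j) + (j - i) in [|| d == 0, d == 1, d == m./2 | d == m.-1].

Definition link (i j : 'I_m) : bool := [|| j == i, j == i.+1 :> nat | i == j + m.-1 :> nat].

(** With m = n - 6 the hubs have degree n - 4 and all other vertices at most n - 5; outside the
    closed neighbourhood of a hub lie exactly the [B j]. *)
Definition hub_graph : rel ('I_3 + ('I_m + 'I_m)) := fun u v =>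
  match u, v with
  | inl h, inl h' => h != h'
  | inl _, inr (inl _) | inr (inl _), inl _ => true
  | inr (inl i), inr (inl j) => ~~ near i j
  | inr (inl i), inr (inr j) | inr (inr j), inr (inl i) => link i j
  | inr (inr i), inr (inr j) => i != j
  | _, _ => false
  end.

Lemma near_sym i j : near i j = near j i.
Proof. by rewrite /near addnC. Qed.

Lemma hub_graph_sym : symmetric hub_graph.
Proof.
by case=> [h|[i|i]] [h'|[j|j]] //=; rewrite ?(near_sym i) // eq_sym.
Qed.

Lemma hub_graph_irr : irreflexive hub_graph.
Proof. by case=> [h|[i|i]] //=; rewrite ?eqxx // /near subnn. Qed.

Lemma sum_const_ord p c : \sum_(i < p) c = p * c.
Proof. by rewrite sum_nat_const card_ord. Qed.

Lemma sum_neq (p : nat) (i : 'I_p) : \sum_(j < p) (i != j) = p.-1.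
Proof.
rewrite sum_card (_ : [set _ | _] = [set~ i]) ?cardsC1 ?card_ord //.
by apply/setP => j; rewrite !inE eq_sym.
Qed.

Lemma ord_of_nat p c : c < p -> exists i : 'I_p, i = c :> nat.
Proof. by move=> cp; exists (Ordinal cp). Qed.

Lemma link_row i : \sum_(j < m) link i j = 2.
Proof.
have [s sE] : exists s : 'I_m, s = (if i.+1 < m then i.+1 else 0) :> nat.
  by apply: ord_of_nat; case: ifP => //; have := ltn_ord i; lia.
rewrite sum_card (_ : [set _ | _] = [set i; s]).
  rewrite cards2; have -> // : i != s.
  apply/eqP => /(congr1 val) /= E; move: sE; rewrite -E; clear -m_ge; case: ifP; lia.
apply/setP => j; rewrite !inE /link -!val_eqE /= sE.
have := ltn_ord i; have := ltn_ord j; clear -m_ge; case: ifP; lia.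
Qed.

Lemma link_col j : \sum_(i < m) link i j = 2.
Proof.
have [s sE] : exists s : 'I_m, s = (if 0 < j then j.-1 else m.-1) :> nat.
  by apply: ord_of_nat; have := ltn_ord j; case: ifP; lia.
rewrite sum_card (_ : [set _ | _] = [set j; s]).
  rewrite cards2; have -> // : j != s.
  apply/eqP => /(congr1 val) /= E; move: sE; rewrite -E; clear -m_ge; case: ifP; lia.
apply/setP => i; rewrite !inE /link -!val_eqE /= sE.
have := ltn_ord i; have := ltn_ord j; clear -m_ge; case: ifP; lia.
Qed.

(** This serves freeness, keeping the degree of [A i] at most m + 1; [near_total] serves the edge
    count. *)
Lemma near_row i : 4 <= \sum_(j < m) near i j.
Proof.
have im := ltn_ord i.
have [s sE] : exists s : 'I_m, s = (if i.+1 < m then i.+1 else 0) :> nat.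
  by apply: ord_of_nat; case: ifP => //; lia.
have [r rE] : exists r : 'I_m, r = (if 0 < i then i.-1 else m.-1) :> nat.
  by apply: ord_of_nat; case: ifP; lia.
have [o oE] : exists o : 'I_m, o = (if i + m./2 < m then i + m./2 else i - m./2) :> nat.
  by apply: ord_of_nat; case: ifP => //; lia.
have us : uniq [:: i; s; r; o].
  rewrite /= !inE !negb_or -!val_eqE /= sE rE oE.
  by clear -m_ge im; do 3!case: ifP; lia.
rewrite sum_card -[4]/(size [:: i; s; r; o]) -(card_uniqP us); apply: subset_leq_card; apply/subsetP => j.
rewrite !inE /near -!(val_eqE j) /= => /or4P[] /eqP ->.
- by rewrite subnn.
- by rewrite sE; clear -m_ge im; case: ifP; lia.
- by rewrite rE; clear -m_ge im; case: ifP; lia.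
- by rewrite oE; clear -m_ge im; case: ifP; lia.
Qed.

Lemma sum_shift c : c <= m -> \sum_(i < m) \sum_(j < m) (i + c == j) <= m - c.
Proof.
move=> cm.
have -> : m - c = \sum_(i < m) (i < m - c).
  rewrite sum_card (_ : [set _ | _] = [set i : 'I_m | 0 <= i < m - c]).
    by rewrite card_ord_range ?leq_subr ?subn0.
  by apply/setP=> i; rewrite !inE.
apply: leq_sum => i _; rewrite sum_card; case: (ltnP i (m - c)) => ic.
  apply/card_le1_eqP => j j'; rewrite !inE => /eqP E /eqP E'.
  by apply: val_inj; rewrite /= -E -E'.
rewrite leqn0 cards_eq0; apply/eqP/setP => j; rewrite !inE.
by have := ltn_ord j; lia.
Qed.

(** Each shift c > 0 contributes m - c in both directions. The bound is 4m for even [m] and 4m + 1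
    for odd [m], where the middle index has two others at distance [m./2]. *)
Lemma near_total : \sum_(i < m) \sum_(j < m) near i j <= 5 * m - 2 * m./2.
Proof.
pose sh c := \sum_(i < m) \sum_(j < m) (i + c == j).
have sh_sym c : \sum_(i < m) \sum_(j < m) (j + c == i) = sh c by rewrite exchange_big.
have : \sum_(i < m) \sum_(j < m) near i j <=
   sh 0 + (sh 1 + sh 1) + (sh m./2 + sh m./2) + (sh m.-1 + sh m.-1).
  rewrite -{2}(sh_sym 1) -{2}(sh_sym m./2) -{2}(sh_sym m.-1) -!big_split /=.
  apply: leq_sum => i _; rewrite -!big_split /=; apply: leq_sum => j _.
  by rewrite /near; clear -m_ge; lia.
have := @sum_shift 0; have := @sum_shift 1; have := @sum_shift m./2.
have := @sum_shift m.-1; rewrite -/(sh 0) -/(sh 1) -/(sh m./2) -/(sh m.-1).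
by clear -m_ge; lia.
Qed.

Lemma sum_near_compl i : \sum_(j < m) ~~ near i j + \sum_(j < m) near i j = m.
Proof.
rewrite -big_split /= -[RHS]muln1 -sum_const_ord.
by apply: eq_bigr => j _; case: near.
Qed.

Lemma deg_hub_hub h : deg hub_graph setT (inl h) = m + 2.
Proof.
rewrite degE (eq_bigl xpredT) => [|w]; last by rewrite inE.
rewrite !big_sumType /= sum_neq sum_const_ord (big1 _ _ (fun=> _)) //.
by rewrite muln1 addn0 addnC.
Qed.

Lemma deg_hub_A i : deg hub_graph setT (inr (inl i)) = \sum_(j < m) ~~ near i j + 5.
Proof.
rewrite degE (eq_bigl xpredT) => [|w]; last by rewrite inE.
by rewrite !big_sumType /= link_row sum_const_ord; lia.
Qed.

Lemma deg_hub_B j : deg hub_graph setT (inr (inr j)) = m.+1.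
Proof.
rewrite degE (eq_bigl xpredT) => [|w]; last by rewrite inE.
rewrite !big_sumType /= link_col sum_neq big1 //; have := ltn_ord j; lia.
Qed.

Lemma sumdeg_hub_graph : 2 * m ^ 2 + 5 * m + 6 <= sumdeg hub_graph setT + odd m.
Proof.
rewrite /sumdeg (eq_bigl xpredT) => [|w]; last by rewrite inE.
rewrite !big_sumType /=.
under eq_bigr do rewrite deg_hub_hub.
rewrite sum_const_ord.
under [X in _ + (X + _)]eq_bigr do rewrite deg_hub_A.
under [X in _ + (_ + X)]eq_bigr do rewrite deg_hub_B.
rewrite big_split /= !sum_const_ord.
have : \sum_(i < m) \sum_(j < m) ~~ near i j + \sum_(i < m) \sum_(j < m) near i j = m * m.
  by rewrite -big_split /= -sum_const_ord; apply: eq_bigr => i _; apply: sum_near_compl.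
have := near_total; have := odd_double_half m; clear; rewrite -mulnn (mulnS m m).
move: (m * m) (nat_of_bool (odd m)) m./2 (\sum_(i < m) _) (\sum_(i < m) _) => M o h s1 s2; lia.
Qed.

Lemma hub_graph_free : dstar_free hub_graph (m + 6).
Proof.
apply: free_of_degree; [exact: hub_graph_sym | exact: hub_graph_irr | lia |].
case=> [h|[i|j]].
- right; rewrite deg_hub_hub; split=> [|a va]; first by lia.
  rewrite degE; apply: (@leq_trans (\sum_w (if w is inr (inr j) then hub_graph a w : nat else 0))).
    rewrite big_mkcond; apply: leq_sum => -[h'|[i|j]] _; last by case: ifP.
      by rewrite !inE /= andbT; case: (eqVneq h h') => [->|hh]; rewrite ?eqxx ?(negPf hh) ?orbT.
    by rewrite !inE /= ?orbT.
  rewrite !big_sumType /= !sum_const_ord !muln0 !add0n.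
  by case: a va => [h'|[i|j]] //= _; rewrite ?link_row ?big1.
- by left; rewrite deg_hub_A; have := near_row i; have := sum_near_compl i; lia.
- by left; rewrite deg_hub_B; lia.
Qed.

End NearRegularGraph.

(** * The two lower bounds and the final count *)

Lemma sumdeg_complete p : sumdeg [rel i j : 'I_p | i != j] setT = p * p.-1.
Proof. by rewrite sumdegT /=; under eq_bigr do rewrite sum_neq; rewrite sum_const_ord. Qed.

Lemma ex_Tn3_cliques n k : 15 <= n ->
  (n - 8) * (n - 9) + k * (n - 1) * (n - 2) <= 2 * ex (k * (n - 1) + n - 8) (Tn3 n).
Proof.
move=> n15; pose W := [rel i j : 'I_(n - 8) | i != j].
have W_sym : symmetric W by move=> i j; rewrite /= eq_sym.
have W_irr : irreflexive W by move=> i; rewrite /= eqxx.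
have W_free : dstar_free W n.
  apply: free_of_degree => // [|v]; first by lia.
  by left; have := deg_lt_card W_irr (in_setT v); rewrite cardsT card_ord; lia.
have n6 : 6 <= n by lia.
have := ex_Tn3_lower n6 (@blocks_sym _ _ k n W_sym) (@blocks_irr _ _ k n W_irr)
  (@blocks_free _ _ k n n6 W_free).
rewrite sumdeg_blocks sumdeg_complete card_sum card_prod !card_ord.
rewrite (_ : (n - 8).-1 = n - 9); last by lia.
by rewrite -[k * _ + n - 8]addnBA 1?[_ + (n - 8)]addnC //; lia.
Qed.

(** The hub graph has 2n - 9 = (n - 1) + (n - 8) vertices, so it takes the place of [K_(n-8)] and
    one [K_(n-1)]. *)
Lemma ex_Tn3_hub n k : 15 <= n -> 0 < k ->
  2 * (n - 6) ^ 2 + 5 * (n - 6) + 6 + k.-1 * (n - 1) * (n - 2) <=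
    2 * ex (k * (n - 1) + n - 8) (Tn3 n) + odd n.
Proof.
move=> n15 k0; have m9 : 9 <= n - 6 by lia.
have n6 : 6 <= n by lia.
have Gfree := hub_graph_free m9; rewrite subnK // in Gfree.
have := ex_Tn3_lower n6 (@blocks_sym _ _ k.-1 n (@hub_graph_sym (n - 6)))
  (@blocks_irr _ _ k.-1 n (@hub_graph_irr (n - 6))) (@blocks_free _ _ k.-1 n n6 Gfree).
have := sumdeg_hub_graph m9; rewrite oddB // addbF.
rewrite sumdeg_blocks !card_sum card_prod !card_ord.
rewrite (_ : 3 + _ + _ = k * (n - 1) + n - 8); first by lia.
by case: k k0 => // k _; rewrite /= (mulSn k); move: (k * _) => N; lia.
Qed.

Theorem theorem4p4 (p n k : nat) :
  15 <= n -> n <= p -> 0 < k -> p = k * (n - 1) + n - 8 ->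
  ex p (Tn3 n) = ((n - 2) * p + 30 - 7 * n) %/ 2 + maxn n./2 13.
Proof.
move=> n15 np k0 pE; have n6 : 6 <= n by lia.
have upper : 2 * ex p (Tn3 n) + minn (7 * n - 56) (6 * n - 30) <= (n - 2) * p.
  have defect_p e : symmetric e -> irreflexive e -> dstar_free e n ->
      sumdeg e [set: 'I_p] + minn (7 * n - 56) (6 * n - 30) <= (n - 2) * p.
    move=> e_sym e_irr e_free.
    have := @defect_class7 _ e e_sym e_irr n n15 e_free k setT.
    rewrite /defect cardsT card_ord; apply; rewrite pE.
    by move: (k * _) => N; lia.
  have min_le : minn (7 * n - 56) (6 * n - 30) <= (n - 2) * p.
    apply: (@leq_trans ((n - 2) * 7)); first by clear -n15; lia.
    by rewrite leq_mul2l; clear -n15 np; lia.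
  have : 2 * ex p (Tn3 n) <= (n - 2) * p - minn (7 * n - 56) (6 * n - 30).
    apply: ex_Tn3_upper => // e e_sym e_irr e_free.
    by rewrite leq_subRL // addnC; apply: defect_p.
  by move: min_le; move: (_ * p) => X; lia.
have cliques := ex_Tn3_cliques k n15; have hub := ex_Tn3_hub n15 k0.
rewrite -pE in cliques hub.
have [m nE] : exists m, n = m + 15 by exists (n - 15); clear -n15; lia.
have [l kE] : exists l, k = l.+1 by exists k.-1; clear -k0; lia.
have XE : (n - 2) * p = l * (n - 1) * (n - 2) + (n - 2) * (2 * n - 9).
  rewrite [l * _ * _]mulnC -mulnDr pE kE (mulSn l); congr (_ * _).
  by move: (l * _) => N; clear -n15; lia.
(* Hence the division by 2 in the formula is exact, and for odd n the bound 6n - 30 on the defect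
   rises to 6n - 29, which the hub graph attains. *)
have parity : odd ((n - 2) * p) = odd n.
  have o1 : odd (n - 1) = ~~ odd n by rewrite oddB ?addbT //; clear -n15; lia.
  have o2 : odd (n - 2) = odd n by rewrite oddB ?addbF //; clear -n15; lia.
  have o9 : odd (2 * n - 9) by rewrite oddB ?oddM //; clear -n15; lia.
  by rewrite XE oddD !oddM o1 o2 o9; case: (odd n); rewrite ?andbF.
have cliquesE : (n - 2) * p = (n - 8) * (n - 9) + k * (n - 1) * (n - 2) + 7 * (n - 8).
  rewrite XE kE nE; have -> : m + 15 - 2 = m + 13 by clear; lia.
  have -> : m + 15 - 1 = m + 14 by clear; lia.
  have -> : m + 15 - 8 = m + 7 by clear; lia.
  have -> : m + 15 - 9 = m + 6 by clear; lia.
  have -> : 2 * (m + 15) - 9 = 2 * m + 21 by clear; lia.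
  by rewrite !mulSn !mulnDl; move: (l * _ * _) => N; clear; lia.
have hubE : (n - 2) * p + 30 =
    2 * (n - 6) ^ 2 + 5 * (n - 6) + 6 + k.-1 * (n - 1) * (n - 2) + 6 * n.
  rewrite XE kE /= nE; have -> : m + 15 - 2 = m + 13 by clear; lia.
  have -> : m + 15 - 6 = m + 9 by clear; lia.
  have -> : 2 * (m + 15) - 9 = 2 * m + 21 by clear; lia.
  by move: (l * _ * _) => N; rewrite -mulnn; clear; lia.
(* With the products as atoms the goal is linear: 7n - 30 exceeds 7n - 56 by 2 * 13 and 6n - 30 by
   n. *)
move: (ex p _) ((n - 2) * p) (k * _ * _) (k.-1 * _ * _) ((n - 8) * _) ((n - 6) ^ 2)
  upper cliques hub parity cliquesE hubE => E X Y Z A B.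
clear -n15; lia.
Qed.
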